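(* Let $Y \in V^n$ be a tuple of samples, and let $G \subseteq \mathrm{GL}(V)$ be a Zariski closed self-adjoint group that is closed under non-zero scalar multiples. The stability of $Y$ under the action of $G_{\mathrm{SL}}^{+}$ on $V^n$ is related to maximum likelihood estimation for the Gaussian group model $\mathcal{M}_G$ as follows: (a) $Y$ is unstable if and only if $\ell_Y$ is not bounded from above on $\mathcal{M}_G$; (b) $Y$ is semistable if and only if $\ell_Y$ is bounded from above on $\mathcal{M}_G$; (c) $Y$ is polystable if and only if an MLE given $Y$ exists; (d) if $Y$ is stable, then finitely many MLEs given $Y$ exist (i.e. the set of MLEs is non-empty and finite); moreover, finitely many MLEs given $Y$ exist if and only if a unique MLE given $Y$ exists.
   Context: $V$ is a finite-dimensional real vector space, identified with $\mathbb{R}^m$, $m=\dim V$, by a fixed isomorphism, so that elements of $\mathrm{GL}(V)$ are invertible real $m\times m$ matrices. A subgroup $G\subseteq \mathrm{GL}(V)$ is closed under non-zero scalar multiples if $cg\in G$ for all $g \in G$, $c\in\mathbb{R}\setminus\{0\}$; Zariski closed if it is the zero locus (in $\mathrm{GL}(V)$) of a set of polynomials in the matrix entries; self-adjoint if $g\in G$ implies $g^{\mathsf T}\in G$. $G_{\mathrm{SL}}^{+}$ is the subgroup of all matrices in $G$ with determinant one. The Gaussian group model given by $G$ is the set of concentration matrices $\mathcal{M}_G=\{g^{\mathsf T}g \mid g\in G\}$. For $Y=(Y_1,\dots,Y_n)\in V^n$, the log-likelihood is $\ell_Y(\Psi)=\log\det(\Psi)-\mathrm{tr}(\Psi S_Y)$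 for $\Psi\in\mathcal{M}_G$, where $S_Y=\frac1n\sum_{i=1}^n Y_iY_i^{\mathsf T}$. An MLE given $Y$ is a matrix in $\mathcal{M}_G$ at which $\ell_Y$ attains its maximum over $\mathcal{M}_G$. The group $G$ acts on $V^n$ by $g\cdot Y=(gY_1,\dots,gY_n)$. Stability notions for a group $H$ acting linearly on a real or complex vector space $W$ and $v\in W$ (closures in the Euclidean topology): $v$ is unstable if $0\in\overline{H\cdot v}$; semistable if $0\notin\overline{H\cdot v}$; polystable if $v\neq0$ and the orbit $H\cdot v$ is closed; stable if $v$ is polystable and its stabilizer in $H$ is finite. *)

(* Defs.v *)
From HB Require Import structures.
From mathcomp Require Import all_boot all_order all_algebra.
From mathcomp Require Import all_classical all_reals all_analysis.
(* [mpoly] is not imported because its notations clash with those of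
   MathComp-Analysis. *)
From mathcomp Require mpoly.

Set Implicit Arguments.
Unset Strict Implicit.
Unset Printing Implicit Defensive.

Import Order.TTheory GRing.Theory Num.Theory.
Import numFieldNormedType.Exports.

Local Open Scope classical_set_scope.
Local Open Scope ring_scope.

(* [act] is meant to be a linear action on [W] of the group [H]. *)

Definition orbit_of (R : realType) (gT : Type) (W : normedModType R)
    (act : gT -> W -> W) (H : set gT) (v : W) : set W :=
  [set act g v | g in H].

Definition stabilizer_of (R : realType) (gT : Type) (W : normedModType R)
    (act : gT -> W -> W) (H : set gT) (v : W) : set gT :=
  [set g | H g /\ act g v = v].

Definition unstable (R : realType) (gT : Type) (W : normedModType R)
    (act : gT -> W -> W) (H : set gT) (v : W) : Prop :=
  closure (orbit_of act H v) 0.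

Definition semistable (R : realType) (gT : Type) (W : normedModType R)
    (act : gT -> W -> W) (H : set gT) (v : W) : Prop :=
  ~ closure (orbit_of act H v) 0.

Definition polystable (R : realType) (gT : Type) (W : normedModType R)
    (act : gT -> W -> W) (H : set gT) (v : W) : Prop :=
  v != 0 /\ closed (orbit_of act H v).

Definition stable (R : realType) (gT : Type) (W : normedModType R)
    (act : gT -> W -> W) (H : set gT) (v : W) : Prop :=
  polystable act H v /\ finite_set (stabilizer_of act H v).

(* With V = R^m, subsets of GL(V) are sets of matrices contained in
   [unitmx]. *)

Definition subgroup_GL (R : realType) (m : nat) (G : set 'M[R]_m) : Prop :=
  [/\ forall g, G g -> g \in unitmx,
      G 1%:M,
      forall g h, G g -> G h -> G (g *m h)
    & forall g, G g -> G (invmx g)].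

Definition scalar_closed (R : realType) (m : nat) (G : set 'M[R]_m) : Prop :=
  forall (c : R) g, c != 0 -> G g -> G (c *: g).

(* The m * m variables are the matrix entries, as listed by [mxvec]. *)
Definition zariski_closed_GL (R : realType) (m : nat) (G : set 'M[R]_m) : Prop :=
  exists P : set (mpoly.mpoly (m * m) R),
    G = [set g | g \in unitmx /\
                 forall p, P p -> mpoly.meval (fun k => mxvec g 0 k) p = 0].

Definition self_adjoint (R : realType) (m : nat) (G : set 'M[R]_m) : Prop :=
  forall g, G g -> G g^T.

Definition SLplus (R : realType) (m : nat) (G : set 'M[R]_m) : set 'M[R]_m :=
  [set g | G g /\ \det g = 1].

Definition gaussian_group_model (R : realType) (m : nat) (G : set 'M[R]_m) :
    set 'M[R]_m :=
  [set g^T *m g | g in G].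

(* A sample tuple (Y_1, ..., Y_n) in V^n is the m x n matrix with columns Y_i;
   the diagonal action of g on V^n is then left multiplication by g, and the
   Euclidean topology of V^n is the topology of ['M_(m, n)]. *)

Definition sample_covariance (R : realType) (m n : nat) (Y : 'M[R]_(m, n)) :
    'M[R]_m :=
  n%:R^-1 *: \sum_(i < n) (col i Y *m (col i Y)^T).

Definition sample_action (R : realType) (m n : nat) (g : 'M[R]_m)
    (Y : 'M[R]_(m, n)) : 'M[R]_(m, n) :=
  g *m Y.

(* Only used for Psi with positive determinant; the library's [ln] is 0 at
   nonpositive arguments. *)
Definition log_likelihood (R : realType) (m n : nat) (Y : 'M[R]_(m, n))
    (Psi : 'M[R]_m) : R :=
  ln (\det Psi) - \tr (Psi *m sample_covariance Y).

Definition likelihood_bounded (R : realType) (m n : nat) (G : set 'M[R]_m)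
    (Y : 'M[R]_(m, n)) : Prop :=
  has_ubound (log_likelihood Y @` gaussian_group_model G).

Definition MLEs (R : realType) (m n : nat) (G : set 'M[R]_m)
    (Y : 'M[R]_(m, n)) : set 'M[R]_m :=
  [set Psi | gaussian_group_model G Psi /\
     forall Phi, gaussian_group_model G Phi ->
       log_likelihood Y Phi <= log_likelihood Y Psi].

(* Main.v *)
(** The maximum, over a ray [u (h^T h)], with [det h = 1] and [u > 0], of the
    log-likelihood [m ln u - (u / n) |h Y|^2] is a decreasing function of
    [|h Y|^2], reached at exactly one [u]; by the polar decomposition in [G] the
    model is the union of these rays over [h] in [SLplus G].  So boundedness and
    MLEs are about the infimum and the minimizers of the norm on the orbit of
    [Y], and what remains is the Kempf-Ness theorem.  An orbit with a minimal
    vector is closed: for [h] in the group, the logarithm [X] of [h^T h]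
    generates a one-parameter subgroup [exp (t X)] of the group (a polynomial
    vanishing on all integer powers of a positive definite matrix vanishes on
    its real powers), [t |-> |exp (t X) Y|^2] is convex, and it is constant only
    if [exp (t X)] fixes [Y].  The same convexity, applied between two distinct
    MLEs, produces infinitely many MLEs and an infinite stabilizer. *)

Require Import Defs.
From mathcomp Require Import all_boot all_order all_algebra.
From mathcomp Require Import all_classical all_reals all_analysis.
From mathcomp Require Import ring lra.
From mathcomp Require mpoly.

Set Implicit Arguments.
Unset Strict Implicit.
Unset Printing Implicit Defensive.

Import Order.TTheory GRing.Theory Num.Theory.
Import numFieldNormedType.Exports.

Local Open Scope classical_set_scope.
Local Open Scope ring_scope.

(** * Limits along an ultrafilter *)

Lemma ultra_eventually : exists U : set_system nat, UltraFilter U /\ \oo `<=` U.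
Proof. exact: ultraFilterLemma. Qed.

(* Limits along a fixed nonprincipal ultrafilter replace the extraction of
   convergent subsequences. *)
Definition uoo : set_system nat := projT1 (cid ultra_eventually).

Lemma uoo_ultra : UltraFilter uoo.
Proof. by rewrite /uoo; case: cid => U []. Qed.

#[local] Existing Instance uoo_ultra.

Lemma uoo_eventually : \oo `<=` uoo.
Proof. by rewrite /uoo; case: cid => U []. Qed.

Lemma uooN (A : set nat) : ~ uoo A -> uoo (~` A).
Proof. by move=> nA; case: (in_ultra_setVsetC A uoo_ultra). Qed.

Lemma fmap_ultra (T V : Type) (f : T -> V) (F : set_system T) :
  UltraFilter F -> UltraFilter (f @ F).
Proof.
move=> FU; split; first exact: fmap_proper_filter.
move=> G GP sFG; apply/seteqP; split => // A GA.
rewrite /fmap /=; case: (in_ultra_setVsetC (f @^-1` A) FU) => // FC.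
have GC : G (~` A) by apply: sFG.
by have [x [Ax nAx]] := @filter_ex _ G _ _ (filterI GA GC).
Qed.

Section UltraLimits.
Variable R : realType.

(** An ultrafilter containing a compact set converges in it; here the set is the segment
    [[- M, M]]. *)
Lemma bounded_ucvg (u : nat -> R) (M : R) :
  (\forall k \near uoo, `|u k| <= M) -> exists l : R, u @ uoo --> l.
Proof.
move=> uM.
have := @segment_compact R (- M) M; rewrite compact_ultra.
move=> /(_ (u @ uoo) (fmap_ultra _ uoo_ultra)).
case; first by apply: filterS uM => k /=; rewrite in_itv /= -ler_norml.
by move=> l [_ ul]; exists l.
Qed.

Lemma ucvg_unique (u : nat -> R) (l1 l2 : R) :
  u @ uoo --> l1 -> u @ uoo --> l2 -> l1 = l2.
Proof. by move=> u1 u2; exact: (@cvg_unique _ (@Rhausdorff R) _ _ l1 l2 u1 u2). Qed.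

Lemma ucvg_sum (I : Type) (r : seq I) (P : pred I) (u : I -> nat -> R) (l : I -> R) :
  (forall i, P i -> u i @ uoo --> l i) ->
  (fun k => \sum_(i <- r | P i) u i k) @ uoo --> \sum_(i <- r | P i) l i.
Proof. by apply: cvg_big; exact: add_continuous. Qed.

Lemma ucvg_prod (I : Type) (r : seq I) (P : pred I) (u : I -> nat -> R) (l : I -> R) :
  (forall i, P i -> u i @ uoo --> l i) ->
  (fun k => \prod_(i <- r | P i) u i k) @ uoo --> \prod_(i <- r | P i) l i.
Proof. by apply: cvg_big; exact: mul_continuous. Qed.

Lemma ucvgX (u : nat -> R) (l : R) n :
  u @ uoo --> l -> (fun k => u k ^+ n) @ uoo --> l ^+ n.
Proof.
move=> ul; elim: n => [|n IH].
  by rewrite expr0; under eq_cvg do rewrite expr0; exact: cvg_cst.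
by rewrite exprS; under eq_cvg do rewrite exprS; exact: cvgM.
Qed.

(** * The squared Frobenius norm *)

Definition sqn p q (A : 'M[R]_(p, q)) : R := \sum_i \sum_j A i j ^+ 2.

Lemma sqnE p q (A : 'M[R]_(p, q)) : sqn A = \tr (A^T *m A).
Proof.
rewrite /sqn exchange_big /mxtrace; apply: eq_bigr => j _.
by rewrite mxE; apply: eq_bigr => i _; rewrite mxE expr2.
Qed.

Lemma sqn_ge0 p q (A : 'M[R]_(p, q)) : 0 <= sqn A.
Proof. by rewrite sumr_ge0 // => i _; rewrite sumr_ge0 // => j _; rewrite sqr_ge0. Qed.

Lemma sqr_le_sqn p q (A : 'M[R]_(p, q)) i j : A i j ^+ 2 <= sqn A.
Proof.
rewrite /sqn (bigD1 i) //= (bigD1 j) //= -addrA lerDl addr_ge0 //.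
  by rewrite sumr_ge0 // => k _; rewrite sqr_ge0.
by rewrite sumr_ge0 // => k _; rewrite sumr_ge0 // => l _; rewrite sqr_ge0.
Qed.

Lemma sqn_eq0 p q (A : 'M[R]_(p, q)) : sqn A = 0 -> A = 0.
Proof.
move=> A0; apply/matrixP => i j; rewrite mxE; apply/eqP.
by rewrite -sqrf_eq0 eq_le sqr_ge0 -A0 sqr_le_sqn.
Qed.

Lemma sqnZ p q c (A : 'M[R]_(p, q)) : sqn (c *: A) = c ^+ 2 * sqn A.
Proof.
rewrite /sqn mulr_sumr; apply: eq_bigr => i _; rewrite mulr_sumr.
by apply: eq_bigr => j _; rewrite mxE exprMn.
Qed.

Lemma sqn0 p q : sqn (0 : 'M[R]_(p, q)) = 0.
Proof. by rewrite -(scale0r 0) sqnZ expr2 !mul0r. Qed.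

Lemma sqn_gt0 p q (A : 'M[R]_(p, q)) : A != 0 -> 0 < sqn A.
Proof.
by move=> A0; rewrite lt0r sqn_ge0 andbT; apply: contraNneq A0 => /sqn_eq0 ->.
Qed.

Lemma sqn_orthomul p q (Q : 'M[R]_p) (A : 'M[R]_(p, q)) :
  Q^T *m Q = 1%:M -> sqn (Q *m A) = sqn A.
Proof. by move=> QQ; rewrite !sqnE trmx_mul mulmxA -(mulmxA A^T) QQ mulmx1. Qed.

(** * Entrywise convergence of matrices along [uoo] *)

Definition mxcvg p q (u : nat -> 'M[R]_(p, q)) (L : 'M[R]_(p, q)) :=
  forall i j, (fun k => u k i j) @ uoo --> L i j.

Lemma mxcvg_unique p q (u : nat -> 'M[R]_(p, q)) L1 L2 :
  mxcvg u L1 -> mxcvg u L2 -> L1 = L2.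
Proof. by move=> u1 u2; apply/matrixP => i j; exact: ucvg_unique (u1 i j) (u2 i j). Qed.

Lemma mxcvg_cst p q (A : 'M[R]_(p, q)) : mxcvg (fun=> A) A.
Proof. by move=> i j; exact: cvg_cst. Qed.

Lemma mxcvgM p q r (u : nat -> 'M[R]_(p, q)) (v : nat -> 'M[R]_(q, r)) A B :
  mxcvg u A -> mxcvg v B -> mxcvg (fun k => u k *m v k) (A *m B).
Proof.
move=> uA vB i j; rewrite mxE; under eq_cvg do rewrite mxE.
by apply: ucvg_sum => l _; apply: cvgM; [exact: uA|exact: vB].
Qed.

Lemma mxcvgT p q (u : nat -> 'M[R]_(p, q)) A :
  mxcvg u A -> mxcvg (fun k => (u k)^T) A^T.
Proof. by move=> uA i j; rewrite mxE; under eq_cvg do rewrite mxE; exact: uA. Qed.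

Lemma mxcvgZ p q (c : nat -> R) (u : nat -> 'M[R]_(p, q)) (l : R) A :
  c @ uoo --> l -> mxcvg u A -> mxcvg (fun k => c k *: u k) (l *: A).
Proof.
move=> cl uA i j; rewrite mxE; under eq_cvg do rewrite mxE.
by apply: cvgM => //; exact: uA.
Qed.

Lemma mxcvg_diag p (u : nat -> 'rV[R]_p) a :
  mxcvg u a -> mxcvg (fun k => diag_mx (u k)) (diag_mx a).
Proof.
move=> ua i j; rewrite mxE; under eq_cvg do rewrite mxE.
by case: (i == j); [exact: ua|exact: cvg_cst].
Qed.

Lemma mxcvg_tr p (u : nat -> 'M[R]_p) A :
  mxcvg u A -> (fun k => \tr (u k)) @ uoo --> \tr A.
Proof. by move=> uA; apply: ucvg_sum => i _; exact: uA. Qed.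

Lemma mxcvg_sqn p q (u : nat -> 'M[R]_(p, q)) A :
  mxcvg u A -> (fun k => sqn (u k)) @ uoo --> sqn A.
Proof.
move=> uA; apply: ucvg_sum => i _; apply: ucvg_sum => j _.
exact/ucvgX/uA.
Qed.

Lemma mxcvg_det p (u : nat -> 'M[R]_p) A :
  mxcvg u A -> (fun k => \det (u k)) @ uoo --> \det A.
Proof.
move=> uA; apply: ucvg_sum => s _; apply: cvgM; first exact: cvg_cst.
by apply: ucvg_prod => i _; exact: uA.
Qed.

Lemma bounded_entries_mxcvg p q (u : nat -> 'M[R]_(p, q)) (M : R) :
  (\forall k \near uoo, forall i j, `|u k i j| <= M) -> exists L, mxcvg u L.
Proof.
move=> uM.
have /choice[l lP] (ij : 'I_p * 'I_q) :
    exists l : R, (fun k => u k ij.1 ij.2) @ uoo --> l.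
  by apply: (@bounded_ucvg _ M); apply: filterS uM.
by exists (\matrix_(i, j) l (i, j)) => i j; rewrite mxE; exact: lP.
Qed.

Lemma bounded_mxcvg p q (u : nat -> 'M[R]_(p, q)) (M : R) :
  (\forall k \near uoo, sqn (u k) <= M) -> exists L, mxcvg u L.
Proof.
move=> uM; apply: (@bounded_entries_mxcvg _ _ _ (1 + M)); apply: filterS uM => k kM i j.
have := le_trans (sqr_le_sqn (u k) i j) kM.
by rewrite -real_normK ?num_real //; nra.
Qed.

Lemma inv_nat_ucvg0 : (fun k => k.+1%:R^-1 : R) @ uoo --> (0 : R).
Proof.
move=> A /(@cvg_harmonic R) HA; exact: uoo_eventually.
Qed.

Lemma closure_mxcvg p q (A : set 'M[R]_(p, q)) Z :
  closure A Z -> exists2 u : nat -> 'M[R]_(p, q), (forall k, A (u k)) & mxcvg u Z.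
Proof.
move=> AZ.
have /choice[u uP] (k : nat) : exists z, A z /\ ball Z (k.+1%:R^-1 : R) z.
  have : nbhs Z (ball Z (k.+1%:R^-1 : R)) by apply: nbhsx_ballx; rewrite invr_gt0.
  by move=> /AZ [z [Az Bz]]; exists z.
exists u => [k|i j]; first by case: (uP k).
apply/cvgrPdist_lt => e e0.
have : \forall k \near uoo, k.+1%:R^-1 < e by exact: (cvgr_lt _ inv_nat_ucvg0).
apply: filterS => k ke; have [_ [_ /(_ i j)]] := uP k.
by rewrite /ball /= => H; exact: lt_trans H ke.
Qed.

Lemma mxcvg_closure p q (A : set 'M[R]_(p, q)) (u : nat -> 'M[R]_(p, q)) Z :
  (forall k, A (u k)) -> mxcvg u Z -> closure A Z.
Proof.
move=> Au uZ B /nbhs_ballP[e /= e0 eB].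
have : \forall k \near uoo, forall i j, ball (Z i j) e (u k i j).
  apply: filter_forall => i; apply: filter_forall => j.
  by move: (uZ i j) => /cvgrPdist_lt /(_ _ e0).
by move=> /filter_ex[k kP]; exists (u k); split => //; apply: eB.
Qed.

(** The direct method. The last hypothesis is compactness of sublevel sets, phrased through the
    values of [f]; it is applied to a sequence whose values are within [1 / (k + 1)] of the
    infimum. *)
Lemma u_argmin (T : Type) (A : set T) (f : T -> R) :
  A !=set0 -> (forall x, 0 <= f x) ->
  (forall (u : nat -> T) (M : R), (forall k, A (u k)) -> (forall k, f (u k) <= M) ->
     exists2 x, A x & (f \o u) @ uoo --> f x) ->
  exists2 x, A x & forall y, A y -> f x <= f y.
Proof.
move=> [x0 Ax0] f0 Acpt.
have fA : has_inf (f @` A).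
  by split; [exists (f x0), x0|exists 0 => _ [x _ <-]].
pose l := inf (f @` A).
have /choice[u uP] (k : nat) : exists x, A x /\ f x < l + k.+1%:R^-1.
  have k0 : 0 < (k.+1%:R^-1 : R) by rewrite invr_gt0.
  by have [_ [x Ax <-] fx] := inf_adherent k0 fA; exists x.
have [||x Ax ux] := Acpt u (l + 1) => [k|k|]; first by case: (uP k).
  case: (uP k) => _ /ltW/le_trans; apply; rewrite lerD2l.
  by rewrite invf_le1 // ler1n.
exists x => // y Ay; apply: (@le_trans _ _ l); last first.
  by apply: ge_inf; [case: fA|exists y].
have ul : (fun k => l + k.+1%:R^-1) @ uoo --> l + 0.
  by apply: cvgD; [exact: cvg_cst|exact: inv_nat_ucvg0].
rewrite -[l]addr0; apply: (ler_cvg_to ux ul).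
by apply: nearW => k /=; rewrite ltW //; case: (uP k).
Qed.

Lemma sqn_argmin p q (A : set 'M[R]_(p, q)) : A !=set0 ->
  (forall u L, (forall k, A (u k)) -> mxcvg u L -> A L) ->
  exists2 x, A x & forall y, A y -> sqn x <= sqn y.
Proof.
move=> A0 Acl; apply: u_argmin => // [x|u M uA uM]; first exact: sqn_ge0.
have [L uL] : exists L, mxcvg u L by apply: (@bounded_mxcvg _ _ _ M); exact: nearW.
by exists L; [exact: Acl uL|exact: mxcvg_sqn].
Qed.

End UltraLimits.

(** * Orthogonal diagonalization of Gram matrices *)

Section Spectral.
Variable R : realType.

Lemma sqnDZ p q (A B : 'M[R]_(p, q)) t :
  sqn (A + t *: B) = sqn A + 2 * t * \tr (A^T *m B) + t ^+ 2 * sqn B.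
Proof.
have trE (C D : 'M[R]_(p, q)) : \tr (C^T *m D) = \sum_i \sum_j C i j * D i j.
  rewrite /mxtrace exchange_big; apply: eq_bigr => j _; rewrite mxE.
  by apply: eq_bigr => i _; rewrite mxE.
rewrite trE /sqn !mulr_sumr -!big_split; apply: eq_bigr => i _.
rewrite !mulr_sumr -!big_split; apply: eq_bigr => j _.
by rewrite /= !mxE; ring.
Qed.

(** At [t = - b / d] with [d = |c| + 1] the expression equals [b^2 (c - 2 d) / d^2], which is
    negative unless [b = 0]. *)
Lemma linear_coef_eq0 (b c : R) : (forall t, 0 <= 2 * t * b + t ^+ 2 * c) -> b = 0.
Proof.
move=> H; pose d := `|c| + 1.
have d0 : 0 < d by rewrite ltr_wpDl.
have cd : c <= d by rewrite (le_trans (ler_norm c)) // lerDl.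
have := H (- b / d).
have -> : 2 * (- b / d) * b + (- b / d) ^+ 2 * c = b ^+ 2 * ((c - d - d) / d ^+ 2).
  by field; rewrite gt_eqF.
move=> h; apply/eqP; rewrite -sqrf_eq0 eq_le sqr_ge0 andbT leNgt; apply/negP => b0.
move: h; rewrite pmulr_rge0 // leNgt => /negP; apply.
rewrite pmulr_llt0 ?invr_gt0 ?exprn_gt0 //; lra.
Qed.

(** The unit sphere is compact, and non-empty in dimension [n.+1]; scaling extends minimality on the
    sphere to all [y]. *)
Lemma min_direction p n (g : 'M[R]_(p, n.+1)) : exists2 x : 'cV[R]_n.+1,
  sqn x = 1 & forall y : 'cV[R]_n.+1, sqn (g *m x) * sqn y <= sqn (g *m y).
Proof.
have [|||x x1 xmin] := @u_argmin R 'cV[R]_n.+1 [set x | sqn x = 1] (fun x => sqn (g *m x)).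
- exists (delta_mx 0 0); rewrite /= sqnE trmx_delta mul_delta_mx /mxtrace.
  by rewrite big_ord1 mxE.
- by move=> x; exact: sqn_ge0.
- move=> u M u1 uM.
  have [L uL] : exists L, mxcvg u L.
    by apply: (@bounded_mxcvg _ _ _ _ 1); apply: nearW => k; rewrite u1.
  exists L; last by apply: mxcvg_sqn; apply: mxcvgM => //; exact: mxcvg_cst.
  apply: (ucvg_unique (mxcvg_sqn uL)).
  by under eq_cvg do rewrite u1; exact: cvg_cst.
exists x => // y; have [->|y0] := eqVneq y 0; first by rewrite mulmx0 !sqn0 mulr0.
have y1 := sqn_gt0 y0.
have := xmin ((Num.sqrt (sqn y))^-1 *: y).
rewrite /= -scalemxAr !sqnZ exprVn sqr_sqrtr ?sqn_ge0 // mulVf ?gt_eqF // => /(_ erefl).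
by rewrite mulrC ler_pdivlMr.
Qed.

Lemma col_mulmx p q r (A : 'M[R]_(p, q)) (B : 'M[R]_(q, r)) j :
  col j (A *m B) = A *m col j B.
Proof. by rewrite !colE mulmxA. Qed.

(** First-order condition at the minimizer [x]: moving along a column [y] of [B], orthogonal to [x],
    gives a nonnegative quadratic without constant term, so its linear coefficient vanishes. *)
Lemma min_direction_ortho p n (g : 'M[R]_(p, n)) (x : 'cV[R]_n) k (B : 'M[R]_(n, k)) :
  sqn x = 1 -> (forall y : 'cV[R]_n, sqn (g *m x) * sqn y <= sqn (g *m y)) ->
  x^T *m B = 0 -> (g *m x)^T *m (g *m B) = 0.
Proof.
move=> x1 xmin xB; apply/matrixP => i j; rewrite ord1 [RHS]mxE.
pose y := col j B.
have xy : \tr (x^T *m y) = 0.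
  by rewrite -col_mulmx xB /mxtrace big_ord1 !mxE.
have -> : ((g *m x)^T *m (g *m B)) 0 j = \tr ((g *m x)^T *m (g *m y)).
  by rewrite /y -!col_mulmx /mxtrace big_ord1 !mxE.
apply: (@linear_coef_eq0 _ (sqn (g *m y) - sqn (g *m x) * sqn y)) => t.
have := xmin (x + t *: y).
rewrite mulmxDr -scalemxAr !sqnDZ x1 xy; lra.
Qed.

(** [B] consists of the last [n] columns of the reflection along [v = x - e], which sends the first
    basis vector [e] to [x]. *)
Lemma householder n (x : 'cV[R]_(1 + n)) : sqn x = 1 ->
  exists B : 'M[R]_(1 + n, n), (row_mx x B)^T *m row_mx x B = 1%:M.
Proof.
move=> x1.
pose e : 'cV[R]_(1 + n) := col_mx 1%:M 0.
have [v vE] : exists v, v = x - e by exists (x - e).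
pose c := 2 / sqn v.
pose H : 'M[R]_(1 + n) := 1%:M - c *: (v *m v^T).
have vv : v^T *m v = (sqn v)%:M.
  by rewrite [LHS]mx11_scalar sqnE /mxtrace big_ord1.
have xx : x^T *m x = 1%:M by rewrite [LHS]mx11_scalar -x1 sqnE /mxtrace big_ord1.
have ee : e^T *m e = 1%:M.
  by rewrite tr_col_mx mul_row_col !trmx1 trmx0 mul0mx addr0 mulmx1.
have HT : H^T = H by rewrite /H linearB linearZ /= trmx1 trmx_mul trmxK.
(* If [x = e], the matrix [H] is the identity whatever the value of [c]. *)
have cv : v = 0 \/ c * sqn v = 2.
  have [->|v0] := eqVneq v 0; [by left|right].
  by rewrite /c mulfVK // gt_eqF // sqn_gt0.
have HH : H^T *m H = 1%:M.
  rewrite HT /H mulmxBr mulmx1 mulmxBl mul1mx -scalemxAl -scalemxAr.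
  have -> : v *m v^T *m (v *m v^T) = sqn v *: (v *m v^T).
    by rewrite -mulmxA (mulmxA v^T) vv mul_scalar_mx -scalemxAr.
  case: cv => [->|cv]; first by rewrite mul0mx !scaler0 !subr0.
  rewrite !scalerA -(mulrA c) cv; set w := v *m v^T.
  by rewrite mulrC mulrDl mul1r scalerDl; apply/matrixP => i j; rewrite !mxE; ring.
have He : H *m e = x.
  rewrite /H mulmxBl mul1mx -scalemxAl -mulmxA.
  have vxe : v + e = x by rewrite vE subrK.
  case: cv => [v0|cv]; first by rewrite -vxe v0 mul0mx scaler0 subr0 add0r.
  have : (v + e)^T *m (v + e) = 1%:M by rewrite vxe.
  have eve : e^T *m v = v^T *m e.
    by rewrite -[LHS]trmxK trmx_mul trmxK [_^T *m _]mx11_scalar tr_scalar_mx.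
  rewrite [(v + e)^T]linearD /= mulmxDl !mulmxDr vv ee eve => E.
  (* Both [e] and [v + e = x] are unit vectors. *)
  have {E}E : v^T *m e = (- (sqn v / 2))%:M.
    move: E; rewrite [v^T *m e]mx11_scalar => /matrixP/(_ 0 0); rewrite !mxE /= => E.
    congr (_%:M); lra.
  by rewrite E mul_mx_scalar scalerA mulrN mulrA cv divff // scaleN1r opprK addrC.
exists (rsubmx H).
have -> : row_mx x (rsubmx H) = H => //.
rewrite -[RHS]hsubmxK; congr row_mx; rewrite -He -[in LHS](hsubmxK H).
by rewrite mul_row_col mulmx1 mulmx0 addr0.
Qed.

(** Induction by deflation: a unit vector [x] minimizing [|g x|] splits off, since its image is
    orthogonal to that of the complement [B], and the induction hypothesis applies to [g *m B]. *)
Lemma gram_spectral p n (g : 'M[R]_(p, n)) : exists (Q : 'M[R]_n) (d : 'rV[R]_n),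
  Q^T *m Q = 1%:M /\ (g *m Q)^T *m (g *m Q) = diag_mx d.
Proof.
elim: n g => [|n IH].
  by move=> g; exists 1%:M, 0; split; apply/matrixP; case.
rewrite -[n.+1]/(1 + n)%N => g.
have [x x1 xmin] := min_direction g.
have [B] := householder x1.
rewrite tr_row_mx mul_col_row => xBE.
have [xx xB Bx BB] := eq_block_mx (etrans xBE (scalar_mx_block 1 n 1)).
have gxB := min_direction_ortho x1 xmin xB.
have [Q [d [QQ gQ]]] := IH (g *m B).
exists (row_mx x (B *m Q)), (row_mx (sqn (g *m x))%:M d); split.
  rewrite tr_row_mx mul_col_row; apply: etrans (esym (scalar_mx_block 1 n 1)).
  congr block_mx => //.
  - by rewrite mulmxA xB mul0mx.
  - by rewrite trmx_mul -mulmxA Bx mulmx0.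
  - by rewrite trmx_mul -mulmxA (mulmxA B^T) BB mul1mx.
rewrite mul_mx_row tr_row_mx mul_col_row (mulmxA g B Q) gQ diag_mx_row.
rewrite (mulmxA _ _ Q) gxB mul0mx.
have -> : (g *m B *m Q)^T *m (g *m x) = 0.
  by rewrite -[LHS]trmxK trmx_mul trmxK (mulmxA _ _ Q) gxB mul0mx trmx0.
congr block_mx; rewrite [LHS]mx11_scalar sqnE /mxtrace big_ord1.
by apply/matrixP => i j; rewrite !ord1 !mxE /= mulr1n.
Qed.

End Spectral.

(** * One-parameter subgroups of Zariski closed groups *)

Section OneParameter.
Variable R : realType.

(** Newton's scheme: a new node is corrected by a multiple of the polynomial [W] vanishing at the
    earlier ones. *)
Lemma interpolation (K : fieldType) (s : seq K) (phi : K -> K) :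
  exists P : {poly K}, {in s, forall x, P.[x] = phi x}.
Proof.
elim: s => [|y s [P PP]]; first by exists 0.
have [ys|ys] := boolP (y \in s).
  by exists P => x; rewrite inE => /orP[/eqP ->|]; exact: PP.
pose W : {poly K} := \prod_(x <- s) ('X - x%:P).
have Wy : W.[y] != 0 by rewrite -[_ == 0]/(root W y) root_prod_XsubC.
exists (P + ((phi y - P.[y]) / W.[y]) *: W) => x; rewrite inE hornerD hornerZ.
have [->|_ /= xs] := eqVneq x y; first by rewrite mulfVK // addrC subrK.
have /rootP -> : root W x by rewrite root_prod_XsubC.
by rewrite mulr0 addr0 PP.
Qed.

(** Each pair is a coefficient and an exponent. These functions form an algebra, hence contain every
    polynomial in the entries of a one-parameter group. *)
Definition is_exp_sum (f : R -> R) :=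
  exists s : seq (R * R), forall t, f t = \sum_(x <- s) x.1 * expR (t * x.2).

Lemma is_exp_sum_cst c : is_exp_sum (fun=> c).
Proof. by exists [:: (c, 0)] => t; rewrite big_seq1 /= mulr0 expR0 mulr1. Qed.

Lemma is_exp_sum_expR a : is_exp_sum (fun t => expR (t * a)).
Proof. by exists [:: (1, a)] => t; rewrite big_seq1 /= mul1r. Qed.

Lemma is_exp_sumD f g : is_exp_sum f -> is_exp_sum g -> is_exp_sum (f \+ g).
Proof. by move=> [s fs] [r gr]; exists (s ++ r) => t; rewrite big_cat /= fs gr. Qed.

Lemma is_exp_sumM f g : is_exp_sum f -> is_exp_sum g -> is_exp_sum (f \* g).
Proof.
move=> [s fs] [r gr].
exists [seq (x.1 * y.1, x.2 + y.2) | x <- s, y <- r] => t.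
rewrite big_allpairs_dep /= fs gr mulr_suml; apply: eq_bigr => x _.
rewrite mulr_sumr; apply: eq_bigr => y _.
by rewrite mulrDr expRD mulrACA.
Qed.

Lemma is_exp_sum_sum (I : Type) (r : seq I) (P : pred I) (f : I -> R -> R) :
  (forall i, is_exp_sum (f i)) -> is_exp_sum (fun t => \sum_(i <- r | P i) f i t).
Proof.
move=> fE; elim: r => [|i r IH].
  by under eq_fun do rewrite big_nil; exact: is_exp_sum_cst.
under eq_fun do rewrite big_cons; case: (P i) => //.
exact: is_exp_sumD.
Qed.

Lemma is_exp_sum_prod (I : Type) (r : seq I) (P : pred I) (f : I -> R -> R) :
  (forall i, is_exp_sum (f i)) -> is_exp_sum (fun t => \prod_(i <- r | P i) f i t).
Proof.
move=> fE; elim: r => [|i r IH].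
  by under eq_fun do rewrite big_nil; exact: is_exp_sum_cst.
under eq_fun do rewrite big_cons; case: (P i) => //.
exact: is_exp_sumM.
Qed.

Lemma is_exp_sumX f n : is_exp_sum f -> is_exp_sum (fun t => f t ^+ n).
Proof.
move=> fE; elim: n => [|n IH].
  by under eq_fun do rewrite expr0; exact: is_exp_sum_cst.
by under eq_fun do rewrite exprS; exact: is_exp_sumM.
Qed.

(* The vanishing says that sum_j c_j P(e^(b_j)) = 0 for every polynomial P, and
   one can interpolate x |-> x^t at the points e^(b_j). *)
Lemma exp_sum_eq0 f : is_exp_sum f -> (forall k : nat, f k%:R = 0) -> forall t, f t = 0.
Proof.
move=> [s fs] f0 t.
have [P PP] := interpolation [seq expR x.2 | x <- s] (fun y => expR (t * ln y)).
have -> : f t = \sum_(x <- s) x.1 * P.[expR x.2].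
  rewrite fs big_seq [RHS]big_seq; apply: eq_bigr => x xs.
  by rewrite PP ?expRK //; apply: map_f.
under eq_bigr do rewrite horner_coef mulr_sumr.
rewrite exchange_big /= big1 // => i _.
have /= := congr1 ( *%R P`_i) (f0 i); rewrite mulr0 fs mulr_sumr => Pf0.
rewrite -[RHS]Pf0.
by apply: eq_bigr => x _; rewrite expRM_natl mulrCA.
Qed.

(** For orthogonal [Q], the exponential of the symmetric matrix [Q *m diag_mx a *m Q^T]; with the
    eigendata explicit, its logarithm is simply [a]. *)
Definition pexp n (Q : 'M[R]_n) (a : 'rV[R]_n) : 'M[R]_n :=
  Q *m diag_mx (map_mx expR a) *m Q^T.

Lemma pexpD n (Q : 'M[R]_n) a b :
  Q^T *m Q = 1%:M -> pexp Q (a + b) = pexp Q a *m pexp Q b.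
Proof.
move=> QQ; rewrite /pexp !mulmxA -(mulmxA _ Q^T) QQ mulmx1.
congr (_ *m _); rewrite -mulmxA mulmx_diag; congr (_ *m diag_mx _).
by apply/rowP => i; rewrite !mxE expRD.
Qed.

Lemma pexp0 n (Q : 'M[R]_n) : Q^T *m Q = 1%:M -> pexp Q 0 = 1%:M.
Proof.
move=> QQ; rewrite /pexp (_ : map_mx _ _ = const_mx 1) ?diag_const_mx.
  by rewrite mulmx1; exact: mulmx1C.
by apply/rowP => i; rewrite !mxE expR0.
Qed.

Lemma pexpT n (Q : 'M[R]_n) a : (pexp Q a)^T = pexp Q a.
Proof. by rewrite /pexp !trmx_mul trmxK tr_diag_mx mulmxA. Qed.

Lemma det_pexp n (Q : 'M[R]_n) a :
  Q^T *m Q = 1%:M -> \det (pexp Q a) = expR (\sum_i a 0 i).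
Proof.
move=> QQ; rewrite /pexp !det_mulmx mulrAC -det_mulmx (mulmx1C QQ) det1 mul1r.
by rewrite det_diag expR_sum; apply: eq_bigr => i _; rewrite mxE.
Qed.

Lemma tr_pexp n (Q : 'M[R]_n) a :
  Q^T *m Q = 1%:M -> \tr (pexp Q a) = \sum_i expR (a 0 i).
Proof.
move=> QQ; rewrite /pexp mxtrace_mulC mulmxA QQ mul1mx mxtrace_diag.
by apply: eq_bigr => i _; rewrite mxE.
Qed.

Lemma pexp_nat n (Q : 'M[R]_n) a (G : set 'M[R]_n) : Q^T *m Q = 1%:M ->
  G 1%:M -> (forall g h, G g -> G h -> G (g *m h)) -> G (pexp Q a) ->
  forall k : nat, G (pexp Q (k%:R *: a)).
Proof.
move=> QQ G1 GM Ga; elim=> [|k IH]; first by rewrite scale0r pexp0.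
by rewrite -natr1 scalerDl scale1r pexpD //; exact: GM.
Qed.

(** A defining polynomial of [G], evaluated along [t |-> pexp Q (t *: a)], is an exponential sum in
    [t]. It vanishes at every natural number, where the point is a power of [pexp Q a], hence
    everywhere. *)
Lemma zariski_pexp m (G : set 'M[R]_m) (Q : 'M[R]_m) (a : 'rV[R]_m) t :
  subgroup_GL G -> zariski_closed_GL G -> Q^T *m Q = 1%:M ->
  G (pexp Q a) -> G (pexp Q (t *: a)).
Proof.
move=> [_ G1 GM _] [P GP] QQ Ga.
have Gk := pexp_nat QQ G1 GM Ga.
rewrite GP; split; first by rewrite unitmxE det_pexp // unitfE gt_eqF ?expR_gt0.
move=> p Pp.
pose f t := mpoly.meval (fun k => mxvec (pexp Q (t *: a)) 0 k) p.
rewrite -/(f t); apply: exp_sum_eq0 => [|k]; last first.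
  by have := Gk k; rewrite GP /f => -[_]; exact.
rewrite /f; under eq_fun do rewrite mpoly.mevalE.
apply: is_exp_sum_sum => mm; apply: is_exp_sumM; first exact: is_exp_sum_cst.
apply: is_exp_sum_prod => k; apply: is_exp_sumX.
case/mxvec_indexP: k => i j; under eq_fun do rewrite mxvecE.
under eq_fun do rewrite /pexp mul_mx_diag mxE.
apply: is_exp_sum_sum => l; under eq_fun do rewrite !mxE.
by do 2 ?[apply: is_exp_sumM]; [exact: is_exp_sum_cst|exact: is_exp_sum_expR|
  exact: is_exp_sum_cst].
Qed.

(** The eigenvalues of [g^T *m g] are the squared norms of the columns of [g *m Q], positive because
    [g] is invertible, so they have logarithms. *)
Lemma gram_pexp n (g : 'M[R]_n) : g \in unitmx ->
  exists (Q : 'M[R]_n) (a : 'rV[R]_n), Q^T *m Q = 1%:M /\ g^T *m g = pexp Q a.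
Proof.
move=> gu; have [Q [d [QQ gQ]]] := gram_spectral g.
exists Q, (map_mx (@ln R) d); split => //.
have d0 i : 0 < d 0 i.
  have -> : d 0 i = sqn (col i (g *m Q)).
    rewrite sqnE /mxtrace big_ord1.
    have /matrixP/(_ i i) := gQ; rewrite [RHS]mxE eqxx mulr1n => <-.
    by rewrite !mxE; apply: eq_bigr => k _; rewrite !mxE.
  apply: sqn_gt0; rewrite col_mulmx.
  have Qu : Q \in unitmx by case: (mulmx1_unit QQ).
  apply/eqP => /(congr1 (mulmx (invmx (g *m Q)))).
  rewrite -col_mulmx colE mulmxA mulVmx ?unitmx_mul ?gu // mul1mx mulmx0.
  by move/matrixP/(_ i 0); rewrite !mxE !eqxx => /eqP; rewrite oner_eq0.
rewrite /pexp (_ : map_mx expR _ = d); last first.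
  by apply/rowP => i; rewrite !mxE lnK // posrE.
rewrite -gQ trmx_mul !mulmxA (mulmx1C QQ) mul1mx.
by rewrite -mulmxA (mulmx1C QQ) mulmx1.
Qed.

End OneParameter.

(** * Kempf-Ness *)

Section KempfNess.
Variable R : realType.

Lemma mxcvg_pexp n (Q : nat -> 'M[R]_n) (a : nat -> 'rV[R]_n) Q0 a0 :
  mxcvg Q Q0 -> mxcvg a a0 -> mxcvg (fun k => pexp (Q k) (a k)) (pexp Q0 a0).
Proof.
move=> QQ0 aa0; apply: mxcvgM; last exact: mxcvgT.
apply: mxcvgM => //; apply: mxcvg_diag => i j; rewrite mxE.
under eq_cvg do rewrite mxE.
by apply: (cvg_comp _ _ (aa0 i j)); exact: continuous_expR.
Qed.

Lemma sqn_pexp m n (Q : 'M[R]_m) a (Y : 'M[R]_(m, n)) : Q^T *m Q = 1%:M ->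
  sqn (pexp Q a *m Y) = \sum_i expR (2 * a 0 i) * sqn (row i (Q^T *m Y)).
Proof.
move=> QQ; rewrite /pexp -!mulmxA sqn_orthomul // mul_diag_mx.
apply: eq_bigr => i _; rewrite /sqn big_ord1 mulr_sumr; apply: eq_bigr => j _.
by rewrite !mxE exprMn expr2 -expRD -mulr2n mulr_natl.
Qed.

Lemma sqn_pexp0 m n (Q : 'M[R]_m) (Y : 'M[R]_(m, n)) : Q^T *m Q = 1%:M ->
  sqn Y = \sum_i sqn (row i (Q^T *m Y)).
Proof.
move=> QQ; rewrite -[in LHS](mul1mx Y) -(pexp0 QQ) sqn_pexp //.
by apply: eq_bigr => i _; rewrite mxE mulr0 expR0 mul1r.
Qed.

(** The tangent to the exponential at [z = l * x] lies below it at [0] ([h1]) and at [x] ([h2]);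
    averaging with weights [1 - l] and [l] cancels the slope term. *)
Lemma expR_chord (l x : R) : 0 <= l <= 1 -> expR (l * x) <= 1 - l + l * expR x.
Proof.
move=> /andP[l0 l1]; set z := l * x.
have z0 := expR_gt0 z.
have h1 : expR z * (1 - z) <= 1.
  have E : expR z * expR (- z) = 1 by rewrite -expRD subrr expR0.
  by rewrite -[leRHS]E ler_pM2l // expR_ge1Dx.
have h2 : expR z * (1 + (x - z)) <= expR x.
  have E : expR z * expR (x - z) = expR x by rewrite -expRD addrC subrK.
  by rewrite -[leRHS]E ler_pM2l // expR_ge1Dx.
have l1' : 0 <= 1 - l by rewrite subr_ge0.
have := lerD (ler_wpM2l l1' h1) (ler_wpM2l l0 h2).
rewrite mulr1; apply: le_trans.
have -> : (1 - l) * (expR z * (1 - z)) + l * (expR z * (1 + (x - z))) =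
    expR z + expR z * (l * x - z) by ring.
by rewrite -/z subrr mulr0 addr0.
Qed.

Lemma sqn_pexp_chord m n (Q : 'M[R]_m) a (Y : 'M[R]_(m, n)) l :
  Q^T *m Q = 1%:M -> 0 <= l <= 1 ->
  sqn (pexp Q (l *: a) *m Y) <= (1 - l) * sqn Y + l * sqn (pexp Q a *m Y).
Proof.
move=> QQ l01; rewrite (sqn_pexp0 Y QQ) !sqn_pexp // !mulr_sumr -big_split /=.
apply: ler_sum => i _; rewrite mulrA -mulrDl ler_wpM2r ?sqn_ge0 //.
by rewrite mxE mulrCA expR_chord.
Qed.

(* Convexity along the one-parameter group: the second difference
   [sum_i w_i (exp (2 b_i) - 1)^2] is nonpositive, so all its terms vanish. *)
Lemma pexp_fixed m n (Q : 'M[R]_m) b (Y : 'M[R]_(m, n)) : Q^T *m Q = 1%:M ->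
  sqn Y <= sqn (pexp Q b *m Y) -> sqn (pexp Q (2 *: b) *m Y) <= sqn Y ->
  forall t, pexp Q (t *: b) *m Y = Y.
Proof.
move=> QQ Y1 Y2 t.
pose w i := sqn (row i (Q^T *m Y)).
have w0 i : 0 <= w i by exact: sqn_ge0.
have sum0 : \sum_i w i * (expR (2 * b 0 i) - 1) ^+ 2 = 0.
  apply/eqP; rewrite eq_le; apply/andP; split; last first.
    by apply: sumr_ge0 => i _; rewrite mulr_ge0 // sqr_ge0.
  have -> : \sum_i w i * (expR (2 * b 0 i) - 1) ^+ 2 =
      sqn (pexp Q (2 *: b) *m Y) - 2 * sqn (pexp Q b *m Y) + sqn Y.
    rewrite (sqn_pexp0 Y QQ) !sqn_pexp // mulr_sumr -sumrB -big_split /=.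
    apply: eq_bigr => i _; rewrite -/(w i) mxE.
    have -> : expR (2 * (2 * b 0 i)) = expR (2 * b 0 i) ^+ 2.
      by rewrite -expRM_natl.
    by ring.
  lra.
have bw i : b 0 i = 0 \/ w i = 0.
  have /eqP : w i * (expR (2 * b 0 i) - 1) ^+ 2 = 0.
    move/eqP: sum0; rewrite psumr_eq0 => [/allP/(_ i)|j _]; last first.
      by rewrite mulr_ge0 // sqr_ge0.
    by rewrite mem_index_enum => /(_ isT)/eqP.
  rewrite mulf_eq0 sqrf_eq0 subr_eq0 => /orP[/eqP|/eqP e1]; [by right|left].
  have : 2 * b 0 i = 0 by apply: expR_inj; rewrite expR0.
  by move=> /eqP; rewrite mulf_eq0 pnatr_eq0 => /eqP.
rewrite /pexp -!mulmxA mul_diag_mx.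
rewrite (_ : \matrix_(i, j) _ = Q^T *m Y); first by rewrite mulmxA (mulmx1C QQ) mul1mx.
apply/matrixP => i j; rewrite mxE [map_mx _ _ _ _]mxE mxE.
case: (bw i) => [->|/sqn_eq0/matrixP/(_ 0 j)]; first by rewrite mulr0 expR0 mul1r.
by rewrite mxE [RHS]mxE => ->; rewrite mulr0.
Qed.

Lemma sqn_mulmx m n p (g : 'M[R]_(p, m)) (Y : 'M[R]_(m, n)) :
  sqn (g *m Y) = \tr (Y^T *m (g^T *m g) *m Y).
Proof. by rewrite sqnE trmx_mul !mulmxA. Qed.

(** The norm of [g *m Y] depends on [g] only through [g^T *m g], of which [pexp Q a] is the positive
    square root. *)
Lemma gram_sqn m n (g : 'M[R]_m) (Q : 'M[R]_m) a (Y : 'M[R]_(m, n)) :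
  Q^T *m Q = 1%:M -> g^T *m g = pexp Q (2 *: a) -> sqn (g *m Y) = sqn (pexp Q a *m Y).
Proof.
move=> QQ gQ; have aa : a + a = 2 *: a by rewrite scaler_nat mulr2n.
by rewrite !sqn_mulmx gQ pexpT -(pexpD a a QQ) aa.
Qed.
End KempfNess.

(** * Minimal vectors and closed orbits, for an abstract group [H] with the properties of
    [SLplus G] *)

Section ClosedOrbit.
Variables (R : realType) (m : nat) (H : set 'M[R]_m).
Hypothesis H1 : H 1%:M.
Hypothesis HM : forall g h, H g -> H h -> H (g *m h).
Hypothesis HV : forall g, H g -> H (invmx g).
Hypothesis HT : forall g, H g -> H g^T.
Hypothesis Hdet : forall g, H g -> \det g = 1.
Hypothesis Hclosed : forall u L, (forall k, H (u k)) -> mxcvg u L -> H L.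
Hypothesis Hpexp : forall Q a t, Q^T *m Q = 1%:M -> H (pexp Q a) -> H (pexp Q (t *: a)).

Lemma group_unit g : H g -> g \in unitmx.
Proof. by move=> /Hdet g1; rewrite unitmxE g1 unitr1. Qed.

(** Here [a] is half the logarithm of [g^T *m g], an element of [H]; determinant one makes its trace
    zero. *)
Lemma polar g : H g -> exists Q a,
  [/\ Q^T *m Q = 1%:M, g^T *m g = pexp Q (2 *: a), \sum_i a 0 i = 0
    & forall t, H (pexp Q (t *: a))].
Proof.
move=> Hg; have [Q [a [QQ gQ]]] := gram_pexp (group_unit Hg).
have Ha : H (pexp Q a) by rewrite -gQ; apply: HM => //; exact: HT.
exists Q, (2^-1 *: a); split => //.
- by rewrite gQ scalerA divff // scale1r.
- have : expR (\sum_i a 0 i) = expR 0 by rewrite -(det_pexp a QQ) Hdet // expR0.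
  move/expR_inj => a0; under eq_bigr do rewrite mxE.
  by rewrite -mulr_sumr a0 mulr0.
- by move=> t; rewrite scalerA; exact: Hpexp.
Qed.

(** The coset of [g] modulo the stabilizer of [Y] is closed, so it has an element of least norm. *)
Lemma stabilizer_argmin n (Y : 'M[R]_(m, n)) g : H g ->
  exists s, [/\ H s, s *m Y = Y &
    forall s', H s' -> s' *m Y = Y -> sqn (g *m s) <= sqn (g *m s')].
Proof.
move=> Hg; have gu := group_unit Hg.
have [||_ [s [Hs sY] <-] smin] :=
    @sqn_argmin R m m [set g *m s | s in [set s | H s /\ s *m Y = Y]].
- by exists (g *m 1%:M), 1%:M => //; rewrite /= mul1mx.
- move=> u L uA uL.
  have ucv : mxcvg (fun k => invmx g *m u k) (invmx g *m L).
    by apply: mxcvgM => //; exact: mxcvg_cst.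
  have uH k : H (invmx g *m u k) /\ invmx g *m u k *m Y = Y.
    by have [s /= [Hs sY] <-] := uA k; rewrite mulmxA mulVmx // mul1mx.
  exists (invmx g *m L); last by rewrite mulmxA mulmxV // mul1mx.
  split; first by apply: Hclosed ucv => k; case: (uH k).
  apply: (@mxcvg_unique _ _ _ (fun k => invmx g *m u k *m Y)).
    by apply: mxcvgM => //; exact: mxcvg_cst.
  by under eq_fun do rewrite (uH _).2; exact: mxcvg_cst.
by exists s; split => // s' Hs' s'Y; apply: smin; exists s'.
Qed.

Lemma unbounded_exponents (Q : nat -> 'M[R]_m) (a : nat -> 'rV[R]_m) :
  (forall k, (Q k)^T *m Q k = 1%:M) ->
  (forall M, \forall k \near uoo, M < \tr (pexp (Q k) (2 *: a k))) ->
  forall t, \forall k \near uoo, t <= \sum_i `|a k 0 i|.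
Proof.
move=> QQ unb t; apply: filterS (unb (m%:R * expR (2 * t))) => k; apply: contraTT.
rewrite -ltNge -leNgt => /ltW kt; rewrite tr_pexp //.
have -> : m%:R * expR (2 * t) = \sum_(i < m) expR (2 * t).
  by rewrite sumr_const card_ord mulr_natl.
apply: ler_sum => i _; rewrite ler_expR mxE ler_pM2l //.
apply: le_trans (ler_norm _) (le_trans _ kt).
by rewrite (bigD1 i) //= lerDl sumr_ge0.
Qed.

Lemma inv_ucvg0 (T : nat -> R) : (forall t, \forall k \near uoo, t <= T k) ->
  (fun k => (T k)^-1) @ uoo --> (0 : R).
Proof.
move=> Too; apply/cvgrPdist_le => e e0; apply: filterS (Too (e^-1)) => k ek.
have ei : 0 < e^-1 by rewrite invr_gt0.
have Tk := lt_le_trans ei ek.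
by rewrite sub0r normrN gtr0_norm ?invr_gt0 // -[e]invrK lef_pV2.
Qed.

(* The eigenvalues [exp (2 a_k)] normalized to sum 1, with [a_k = T_k b_k],
   concentrate on the indices where the limit of [b_k] is positive. *)
Lemma concentration (a : nat -> 'rV[R]_m) (T : nat -> R) (b gam : 'rV[R]_m) :
  (forall t, \forall k \near uoo, t <= T k) ->
  mxcvg (fun k => (T k)^-1 *: a k) b ->
  mxcvg (fun k => (\sum_j expR (2 * a k 0 j))^-1 *: \row_i expR (2 * a k 0 i)) gam ->
  forall i j, b 0 i <= 0 -> 0 < b 0 j -> gam 0 i = 0.
Proof.
move=> Too ab agam i j bi bj; apply/eqP; rewrite eq_le; apply/andP; split.
  (* Since [b 0 i <= 0], the limit gap [b 0 j - b 0 i] exceeds [d], so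
     [a k 0 j - a k 0 i >= d * T k] eventually. *)
  pose d := b 0 j / 2.
  have d0 : 0 < d by rewrite divr_gt0.
  have Td : (fun k => d^-1 * (T k)^-1) @ uoo --> d^-1 * 0.
    by apply: cvgM; [exact: cvg_cst|exact: inv_ucvg0].
  rewrite -[leRHS](mulr0 d^-1); apply: (ler_cvg_to (agam 0 i) Td).
  have bij : (fun k => ((T k)^-1 *: a k) 0 j - ((T k)^-1 *: a k) 0 i) @ uoo -->
      b 0 j - b 0 i by apply: cvgB; exact: ab.
  have dij : d < b 0 j - b 0 i by rewrite /d; lra.
  near=> k.
  have Tk : 0 < T k by apply: (@lt_le_trans _ _ 1) => //; near: k; exact: Too.
  have : d <= ((T k)^-1 *: a k) 0 j - ((T k)^-1 *: a k) 0 i.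
    by near: k; exact: (cvgr_ge _ bij).
  rewrite !mxE -mulrBr mulrC ler_pdivlMr // => dT.
  have S0 : expR (2 * a k 0 j) <= \sum_l expR (2 * a k 0 l).
    by rewrite (bigD1 j) //= lerDl sumr_ge0 // => l _; exact: expR_ge0.
  (* Bounding the sum below by its term [j], the normalized eigenvalue is at most
     [exp (- 2 d T_k) <= 1 / (d T_k)]. *)
  apply: (@le_trans _ _ ((expR (2 * a k 0 j))^-1 * expR (2 * a k 0 i))).
    by rewrite ler_wpM2r ?expR_ge0 // lef_pV2 // posrE ?expR_gt0 // (lt_le_trans _ S0) ?expR_gt0.
  rewrite -expRN -expRD -invfM -[leLHS]invrK lef_pV2 ?posrE ?mulr_gt0 ?invr_gt0 ?expR_gt0 //.
  rewrite -expRN; apply: le_trans (expR_ge1Dx _).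
  have dT0 : 0 <= d * T k by rewrite mulr_ge0 // ltW.
  lra.
have c0 : (fun=> 0 : R) @ uoo --> (0 : R) by exact: cvg_cst.
apply: (ler_cvg_to c0 (agam 0 i)); apply: nearW => k; rewrite !mxE mulr_ge0 ?expR_ge0 //.
by rewrite invr_ge0 sumr_ge0 // => l _; exact: expR_ge0.
Unshelve. all: by end_near. Qed.

(** If the norms of [q k] blow up, their normalized logarithms [b k] tend to a direction [b0] whose
    one-parameter group fixes [Y]. Right multiplication by [exp (- b0)] then shrinks [q k] along the
    filter, against its minimality in the coset. *)
Lemma stabilizer_minimal_bounded n (Y : 'M[R]_(m, n)) (q : nat -> 'M[R]_m) (C : R) :
  (forall h, H h -> sqn Y <= sqn (h *m Y)) -> (forall k, H (q k)) ->
  (forall k s, H s -> s *m Y = Y -> sqn (q k) <= sqn (q k *m s)) ->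
  (\forall k \near uoo, sqn (q k *m Y) <= C) ->
  exists M, \forall k \near uoo, sqn (q k) <= M.
Proof.
move=> Ymin Hq qmin qC; apply: contrapT => /forallNP unb.
have {}unb M : \forall k \near uoo, M < sqn (q k).
  by apply: filterS (uooN (unb M)) => k /negP; rewrite -ltNge.
have /choice[Q /choice[a Qa]] k := polar (Hq k).
have QQ k : (Q k)^T *m Q k = 1%:M by case: (Qa k).
have qQ k : (q k)^T *m q k = pexp (Q k) (2 *: a k) by case: (Qa k).
have a0 k : \sum_i a k 0 i = 0 by case: (Qa k).
have Ha k t : H (pexp (Q k) (t *: a k)) by case: (Qa k).
pose T k := \sum_i `|a k 0 i|.
have sqnq k : sqn (q k) = \sum_i expR (2 * a k 0 i).
  by rewrite sqnE qQ tr_pexp //; apply: eq_bigr => i _; rewrite mxE.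
have Too t : \forall k \near uoo, t <= T k.
  apply: (unbounded_exponents QQ) => M; apply: filterS (unb M) => k.
  by rewrite sqnE qQ.
have T0 : \forall k \near uoo, 0 < T k.
  by apply: filterS (Too 1) => k; exact: lt_le_trans.
pose b k := (T k)^-1 *: a k.
have b1 : \forall k \near uoo, \sum_i `|b k 0 i| = 1.
  apply: filterS T0 => k Tk.
  under eq_bigr do rewrite mxE normrM gtr0_norm ?invr_gt0 //.
  by rewrite -mulr_sumr mulVf // gt_eqF.
have [Q0 QQ0] : exists Q0, mxcvg Q Q0.
  apply: (@bounded_mxcvg _ _ _ _ m%:R); apply: nearW => k.
  by rewrite sqnE QQ mxtrace1.
have [b0 bb0] : exists b0, mxcvg b b0.
  apply: (@bounded_entries_mxcvg _ _ _ _ 1); apply: filterS b1 => k b1 i j.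
  by rewrite ord1 -b1 (bigD1 j) //= lerDl sumr_ge0.
have QQ1 : Q0^T *m Q0 = 1%:M.
  apply: (@mxcvg_unique _ _ _ (fun k => (Q k)^T *m Q k)).
    by apply: mxcvgM => //; exact: mxcvgT.
  by under eq_fun do rewrite QQ; exact: mxcvg_cst.
have sumb : \sum_i b0 0 i = 0.
  apply: (@ucvg_unique _ (fun k => \sum_i b k 0 i)).
    by apply: ucvg_sum => i _; exact: bb0.
  have -> : (fun k => \sum_i b k 0 i) = fun=> 0.
    apply/funext => k; under eq_bigr do rewrite mxE.
    by rewrite -mulr_sumr a0 mulr0.
  exact: cvg_cst.
have normb : \sum_i `|b0 0 i| = 1.
  apply: (@ucvg_unique _ (fun k => \sum_i `|b k 0 i|)).
    by apply: ucvg_sum => i _; apply: cvg_norm; exact: bb0.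
  by apply: cvg_near_cst.
(* The entries of [b0] sum to zero, and their absolute values to one. *)
have [j bj] : exists j, 0 < b0 0 j.
  apply: contrapT => /forallNP bneg.
  have {}bneg i : b0 0 i <= 0 by rewrite leNgt; apply/negP.
  move: normb; under eq_bigr do rewrite ler0_norm //.
  by rewrite sumrN sumb oppr0 => /eqP; rewrite eq_sym oner_eq0.
have bcvg t : mxcvg (fun k => pexp (Q k) (t *: b k)) (pexp Q0 (t *: b0)).
  by apply: mxcvg_pexp => //; apply: mxcvgZ => //; exact: cvg_cst.
have Hb t : H (pexp Q0 (t *: b0)).
  by apply: Hclosed (bcvg t) => k; rewrite scalerA.
(* By convexity, at the fraction [2 / T_k] of the way from the identity to [pexp (Q k) (a k)], the
   squared norm is at most [(1 - 2 / T_k) |Y|^2 + (2 / T_k) C], which tends to [|Y|^2]. *)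
have stab : forall t, pexp Q0 (t *: b0) *m Y = Y.
  apply: pexp_fixed => //; first by rewrite -[b0]scale1r; exact: Ymin.
  have cvl : (fun k => sqn (pexp (Q k) (2 *: b k) *m Y)) @ uoo -->
      sqn (pexp Q0 (2 *: b0) *m Y).
    by apply: mxcvg_sqn; apply: mxcvgM => //; exact: mxcvg_cst.
  have cvr : (fun k => (1 - 2 * (T k)^-1) * sqn Y + 2 * (T k)^-1 * C) @ uoo -->
      (1 - 2 * 0) * sqn Y + 2 * 0 * C.
    have T2 : (fun k => 2 * (T k)^-1) @ uoo --> 2 * (0 : R).
      by apply: cvgM; [exact: cvg_cst|exact: inv_ucvg0].
    apply: cvgD; apply: cvgM => //; try exact: cvg_cst.
    by apply: cvgB => //; exact: cvg_cst.
  have := ler_cvg_to cvl cvr.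
  rewrite mulr0 subr0 mul1r mul0r addr0; apply.
  apply: filterS2 (Too 2) qC => k T2 kC.
  have Tk : 0 < T k by exact: lt_le_trans T2.
  rewrite /b scalerA; apply: le_trans (sqn_pexp_chord _ _ (QQ k) _) _.
    by rewrite mulr_ge0 ?invr_ge0 ?(ltW Tk) //= ler_pdivrMr // mul1r.
  rewrite lerD2l; apply: ler_wpM2l; first by rewrite mulr_ge0 // invr_ge0 ltW.
  by rewrite -(gram_sqn _ (QQ k) (qQ k)).
(* [D k] lists the eigenvalues of [(q k)^T *m q k], and [S k] is their sum [sqn (q k)]. *)
pose D k : 'rV[R]_m := \row_i expR (2 * a k 0 i).
pose S k := \sum_i expR (2 * a k 0 i).
have SD k i : D k 0 i <= S k.
  by rewrite mxE /S (bigD1 i) //= lerDl sumr_ge0 // => l _; exact: expR_ge0.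
have S0 k : 0 < S k by apply: lt_le_trans (SD k j); rewrite mxE expR_gt0.
have [gam Dgam] : exists gam, mxcvg (fun k => (S k)^-1 *: D k) gam.
  apply: (@bounded_entries_mxcvg _ _ _ _ 1); apply: nearW => k i l.
  rewrite ord1 mxE mulrC ger0_norm; first by rewrite ler_pdivrMr // mul1r.
  by rewrite mulr_ge0 ?invr_ge0 ?(ltW (S0 k)) // mxE expR_ge0.
have sumgam : \sum_i gam 0 i = 1.
  apply: (@ucvg_unique _ (fun k => \sum_i ((S k)^-1 *: D k) 0 i)).
    by apply: ucvg_sum => i _; exact: Dgam.
  have -> : (fun k => \sum_i ((S k)^-1 *: D k) 0 i) = fun=> 1.
    apply/funext => k; under eq_bigr do rewrite !mxE.
    by rewrite -mulr_sumr mulVf // gt_eqF.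
  exact: cvg_cst.
have gam0 i : 0 <= gam 0 i.
  have c0 : (fun=> 0 : R) @ uoo --> (0 : R) by exact: cvg_cst.
  apply: (ler_cvg_to c0 (Dgam 0 i)); apply: nearW => k.
  by rewrite !mxE mulr_ge0 ?expR_ge0 // invr_ge0 ltW.
have conc := concentration Too bb0 Dgam.
pose E := pexp Q0 (-1 *: b0).
(* Minimality of [q k] against [q k *m E], with [E] in the stabilizer, divided by [S k] and passed
   to the limit. *)
have : 1 <= \sum_i gam 0 i * expR (- 2 * b0 0 i).
  have -> : \sum_i gam 0 i * expR (- 2 * b0 0 i) =
      \tr (E^T *m (Q0 *m diag_mx gam *m Q0^T) *m E).
    have EE : E *m E^T = pexp Q0 (- 2 *: b0).
      rewrite [E^T]pexpT -pexpD //; congr (pexp _ _).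
      by rewrite -scalerDl; congr (_ *: _); ring.
    rewrite mxtrace_mulC (mulmxA E E^T) EE /pexp mxtrace_mulC !mulmxA.
    rewrite -(mulmxA _ Q0^T Q0) QQ1 mulmx1.
    rewrite mxtrace_mulC !mulmxA QQ1 mul1mx mulmx_diag mxtrace_diag.
    apply: eq_bigr => i _; by rewrite !mxE mulrC.
  have cv : (fun k => \tr (E^T *m (Q k *m diag_mx ((S k)^-1 *: D k) *m (Q k)^T) *m E))
      @ uoo --> \tr (E^T *m (Q0 *m diag_mx gam *m Q0^T) *m E).
    apply: mxcvg_tr; apply: mxcvgM; last exact: mxcvg_cst.
    apply: mxcvgM; first exact: mxcvg_cst.
    by apply: mxcvgM; [apply: mxcvgM => //; exact: mxcvg_diag|exact: mxcvgT].
  have c1 : (fun=> 1 : R) @ uoo --> (1 : R) by exact: cvg_cst.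
  apply: (ler_cvg_to c1 cv); apply: nearW => k.
  have -> : Q k *m diag_mx ((S k)^-1 *: D k) *m (Q k)^T = (S k)^-1 *: ((q k)^T *m q k).
    rewrite qQ /pexp linearZ /= -scalemxAr -scalemxAl; congr (_ *: (_ *m diag_mx _ *m _)).
    by apply/rowP => i; rewrite !mxE.
  rewrite -scalemxAr -scalemxAl linearZ /= -sqn_mulmx mulrC ler_pdivlMr // mul1r.
  by rewrite -[S k]sqnq; apply: qmin; [exact: Hb|exact: stab].
(* By [conc], [gam] is supported where [b0] is positive, so the weights [exp (- 2 b0)] bring its sum
   strictly below one. *)
rewrite -[leLHS]sumgam leNgt => /negP; apply.
have [i gi] : exists i, 0 < gam 0 i.
  apply: contrapT => /forallNP gneg.
  have gz i : gam 0 i = 0.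
    by apply/eqP; rewrite eq_le gam0 andbT leNgt; apply/negP.
  by move/eqP: sumgam; rewrite big1 // eq_sym oner_eq0.
have lt1 l : 0 < gam 0 l -> gam 0 l * expR (- 2 * b0 0 l) < gam 0 l.
  move=> gl; rewrite gtr_pMr // expR_lt1 mulNr oppr_lt0 mulr_gt0 //.
  by rewrite ltNge; apply/negP => bl; rewrite (conc l j) ?ltxx in gl.
rewrite (bigD1 i) //= [ltRHS](bigD1 i) //=; apply: ltr_leD; first exact: lt1.
apply: ler_sum => l _; have [/lt1/ltW//|gl] := ltP 0 (gam 0 l).
by rewrite (_ : gam 0 l = 0) ?mul0r //; apply/eqP; rewrite eq_le gl gam0.
Qed.

(* An element of the orbit closure is a limit of [g_k Y]; moving
   [g_k] inside its coset modulo the stabilizer of [Y], one may assume that its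
   norm is minimal, and then the sequence is bounded. *)
Lemma minimal_closed n (Y Z : 'M[R]_(m, n)) (g : nat -> 'M[R]_m) :
  (forall h, H h -> sqn Y <= sqn (h *m Y)) -> (forall k, H (g k)) ->
  mxcvg (fun k => g k *m Y) Z -> exists2 h, H h & h *m Y = Z.
Proof.
move=> Ymin Hg gZ.
have /choice[s sP] k := stabilizer_argmin Y (Hg k).
pose q k := g k *m s k.
have Hq k : H (q k) by apply: HM => //; case: (sP k).
have qY k : q k *m Y = g k *m Y by rewrite -mulmxA; case: (sP k) => _ ->.
have qmin k t : H t -> t *m Y = Y -> sqn (q k) <= sqn (q k *m t).
  move=> Ht tY; rewrite -mulmxA; case: (sP k) => Hs sY; apply; first exact: HM.
  by rewrite -mulmxA tY.
have qC : \forall k \near uoo, sqn (q k *m Y) <= sqn Z + 1.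
  under eq_near do rewrite qY; apply: (cvgr_le _ (mxcvg_sqn gZ)).
  by rewrite ltrDl.
have [M qM] := stabilizer_minimal_bounded Ymin Hq qmin qC.
have [h qh] := bounded_mxcvg qM.
exists h; first exact: Hclosed qh.
apply: (mxcvg_unique _ gZ); under eq_fun do rewrite -qY.
by apply: mxcvgM => //; exact: mxcvg_cst.
Qed.

(** The element [h *m invmx g] takes the minimal vector [g *m Y] to another one. The logarithm of
    its positive part is nonzero, as the Gram matrices differ, and convexity makes it fix
    [g *m Y]. *)
Lemma polar_pair n (Y : 'M[R]_(m, n)) g h :
  (forall h', H h' -> sqn (g *m Y) <= sqn (h' *m Y)) -> H g -> H h ->
  sqn (h *m Y) = sqn (g *m Y) -> h^T *m h <> g^T *m g ->
  exists Q b, [/\ Q^T *m Q = 1%:M, b != 0, forall t, H (pexp Q (t *: b)) &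
    forall t, pexp Q (t *: b) *m (g *m Y) = g *m Y].
Proof.
move=> gmin Hg Hh hg neq.
have gu := group_unit Hg.
have Hk : H (h *m invmx g) by apply: HM => //; exact: HV.
have [Q [b [QQ kQ _ Hb]]] := polar Hk.
exists Q, b; split => //.
  apply: contra_notN neq => /eqP b0; move: kQ; rewrite b0 scaler0 pexp0 //.
  move=> /(congr1 (fun A => g^T *m A *m g)); rewrite mulmx1 trmx_mul => <-.
  by rewrite !mulmxA -trmx_mul mulVmx // trmx1 mul1mx mulmxKV.
(* With the halved direction, minimality gives the bound at the midpoint [pexp Q (2^-1 *: b)], and
   the endpoint [pexp Q b] gives the norm of [h *m Y]. *)
have fixed : forall t, pexp Q (t *: (2^-1 *: b)) *m (g *m Y) = g *m Y.
  apply: pexp_fixed => //; first by rewrite mulmxA; apply: gmin; apply: HM.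
  rewrite scalerA divff // scale1r -(gram_sqn _ QQ kQ) mulmxA mulmxKV //.
  by rewrite hg.
by move=> t; have := fixed (t * 2); rewrite scalerA mulfK.
Qed.

End ClosedOrbit.

(** * The Gaussian group model *)

Lemma gramZ (R : comPzRingType) p q (c : R) (A : 'M[R]_(p, q)) :
  (c *: A)^T *m (c *: A) = c ^+ 2 *: (A^T *m A).
Proof. by rewrite [(c *: A)^T]linearZ /= -scalemxAl -scalemxAr scalerA. Qed.

(** * The group [SLplus G] and the rays that make up the model *)

Section SLplusGroup.
Variables (R : realType) (m : nat) (G : set 'M[R]_m).
Hypothesis m_gt0 : (0 < m)%N.
Hypothesis G_subgroup : subgroup_GL G.
Hypothesis G_zariski_closed : zariski_closed_GL G.
Hypothesis G_self_adjoint : self_adjoint G.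
Hypothesis G_scalar_closed : scalar_closed G.

Local Notation H := (SLplus G).

Lemma SLplus1 : H 1%:M.
Proof. by case: G_subgroup => _ G1 _ _; split => //; rewrite det1. Qed.

Lemma SLplusM g h : H g -> H h -> H (g *m h).
Proof.
case: G_subgroup => _ _ GM _ [Gg g1] [Gh h1]; split; first exact: GM.
by rewrite det_mulmx g1 h1 mulr1.
Qed.

Lemma SLplusV g : H g -> H (invmx g).
Proof.
case: G_subgroup => _ _ _ GV [Gg g1]; split; first exact: GV.
by rewrite det_inv g1 invr1.
Qed.

Lemma SLplusT g : H g -> H g^T.
Proof. by move=> [Gg g1]; split; [exact: G_self_adjoint|rewrite det_tr]. Qed.

Lemma SLplus_det g : H g -> \det g = 1.
Proof. by case. Qed.

(** [G] is the zero locus only among invertible matrices; determinant one keeps the limit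
    invertible. *)
Lemma SLplus_closed u L : (forall k, H (u k)) -> mxcvg u L -> H L.
Proof.
move=> Hu uL; have L1 : \det L = 1.
  apply: (ucvg_unique (mxcvg_det uL)).
  by under eq_fun do rewrite (Hu _).2; exact: cvg_cst.
split => //; have [P GP] := G_zariski_closed.
rewrite GP; split; first by rewrite unitmxE L1 unitr1.
move=> p Pp; apply: (@ucvg_unique _ (fun k => mpoly.meval (fun l => mxvec (u k) 0 l) p)).
  rewrite mpoly.mevalE; under eq_fun do rewrite mpoly.mevalE.
  apply: ucvg_sum => mm _; apply: cvgM; first exact: cvg_cst.
  apply: ucvg_prod => k _; apply: ucvgX; case/mxvec_indexP: k => i j.
  by rewrite mxvecE; under eq_fun do rewrite mxvecE; exact: uL.
rewrite (_ : (fun k => _) = fun=> 0); first exact: cvg_cst.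
by apply/funext => k; have [] := Hu k; rewrite GP => -[_ /(_ p Pp)].
Qed.

Lemma SLplus_pexp Q a t : Q^T *m Q = 1%:M -> H (pexp Q a) -> H (pexp Q (t *: a)).
Proof.
move=> QQ [Ga]; rewrite det_pexp // -(@expR0 R) => /expR_inj a0.
split; first exact: zariski_pexp Ga.
rewrite det_pexp //; under eq_bigr do rewrite mxE.
by rewrite -mulr_sumr a0 mulr0 expR0.
Qed.

(* The polar decomposition replaces a matrix of negative determinant by one of
   positive determinant with the same Gram matrix. *)
Lemma modelP Psi : gaussian_group_model G Psi <->
  exists u h, [/\ 0 < u, H h & Psi = u *: (h^T *m h)].
Proof.
split=> [[g Gg <-]|[u [h [u0 [Gh _] ->]]]]; last first.
  exists (Num.sqrt u *: h); first by apply: G_scalar_closed; rewrite ?gt_eqF ?sqrtr_gt0.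
  by rewrite gramZ sqr_sqrtr // ltW.
case: G_subgroup => Gu _ GM _.
have [Q [a [QQ gQ]]] := gram_pexp (Gu _ Gg).
have Ga : G (pexp Q a) by rewrite -gQ; apply: GM => //; exact: G_self_adjoint.
(* The [m]-th root of the determinant of [pexp Q (2^-1 *: a)], so that dividing by [c] gives
   determinant one. *)
pose c : R := expR (m%:R^-1 * \sum_i (2^-1 *: a) 0 i).
have c0 : 0 < c by exact: expR_gt0.
exists (c ^+ 2), (c^-1 *: pexp Q (2^-1 *: a)); split; first by rewrite exprn_gt0.
  split.
    apply: G_scalar_closed; first by rewrite invr_neq0 // gt_eqF.
    exact: zariski_pexp.
  rewrite detZ det_pexp // exprVn -expRM_natl mulrA divff ?mul1r ?mulVf //.
    by rewrite gt_eqF ?expR_gt0.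
  by rewrite pnatr_eq0 -lt0n.
have aa : 2^-1 *: a + 2^-1 *: a = a.
  by apply/rowP => i; rewrite !mxE; field.
rewrite gramZ scalerA -exprMn divff ?gt_eqF // expr1n scale1r pexpT -pexpD //.
by rewrite aa.
Qed.

End SLplusGroup.

(** * The log-likelihood along a ray *)

Section Likelihood.
Variables (R : realType) (m n : nat) (Y : 'M[R]_(m, n)).
Hypotheses (m_gt0 : (0 < m)%N) (n_gt0 : (0 < n)%N).

Lemma sample_covarianceE : sample_covariance Y = n%:R^-1 *: (Y *m Y^T).
Proof.
rewrite /sample_covariance; congr (_ *: _); apply/matrixP => i j.
rewrite summxE mxE; apply: eq_bigr => k _.
by rewrite !mxE big_ord1 !mxE.
Qed.

Lemma log_likelihood_gram u (h : 'M[R]_m) : 0 < u -> \det h = 1 ->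
  log_likelihood Y (u *: (h^T *m h)) = m%:R * ln u - u * (sqn (h *m Y) / n%:R).
Proof.
move=> u0 h1; rewrite /log_likelihood detZ det_mulmx det_tr h1 !mulr1 lnXn //.
rewrite mulr_natl; congr (_ - _).
rewrite sample_covarianceE -scalemxAl -scalemxAr scalerA linearZ /= -mulrA.
congr (_ * _); rewrite mulrC; congr (_ * _).
by rewrite sqn_mulmx (mulmxA _ Y) mxtrace_mulC !mulmxA.
Qed.

Lemma ln_le_subr1 (y : R) : 0 < y -> ln y <= y - 1.
Proof. by move=> y0; rewrite lerBrDl -[leRHS](@lnK R) ?posrE // expR_ge1Dx. Qed.

Lemma ln_eq_subr1 (y : R) : 0 < y -> y - 1 <= ln y -> y = 1.
Proof.
move=> y0 yln; have [l0|l0] := eqVneq (ln y) 0.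
  by rewrite -[y](@lnK R) ?posrE // l0 expR0.
by have := expR_gt1Dx l0; rewrite (@lnK R) ?posrE // ltNge -lerBlDl yln.
Qed.

(** With [y = u * A / m], all dependence on [u] is in [ln y - (y - 1)], which is nonpositive and
    vanishes only at [y = 1], that is at [u = m / A]. *)
Lemma ln_scale_split (u A : R) : 0 < u -> 0 < A ->
  m%:R * ln u - u * A =
  m%:R * (ln (u * A / m%:R) - (u * A / m%:R - 1)) + m%:R * (ln (m%:R / A) - 1).
Proof.
move=> u0 A0; have M0 : 0 < m%:R :> R by rewrite ltr0n.
have uE : u = u * A / m%:R * (m%:R / A) by field; rewrite !gt_eqF.
rewrite {1}uE lnM ?posrE ?divr_gt0 ?mulr_gt0 //; field.
by rewrite gt_eqF.
Qed.

Lemma scale_le (u A : R) : 0 < u -> 0 < A ->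
  m%:R * ln u - u * A <= m%:R * (ln (m%:R / A) - 1).
Proof.
move=> u0 A0; have M0 : 0 < m%:R :> R by rewrite ltr0n.
rewrite ln_scale_split // gerDr pmulr_rle0 // subr_le0.
by apply: ln_le_subr1; rewrite divr_gt0 ?mulr_gt0.
Qed.

Lemma scale_max (A : R) : 0 < A ->
  m%:R * ln (m%:R / A) - m%:R / A * A = m%:R * (ln (m%:R / A) - 1).
Proof. by move=> A0; rewrite mulfVK ?gt_eqF // mulrBr mulr1. Qed.

Lemma scale_max_unique (u A : R) : 0 < u -> 0 < A ->
  m%:R * (ln (m%:R / A) - 1) <= m%:R * ln u - u * A -> u = m%:R / A.
Proof.
move=> u0 A0; have M0 : 0 < m%:R :> R by rewrite ltr0n.
rewrite ln_scale_split // lerDr pmulr_rge0 // subr_ge0 => /ln_eq_subr1 uA.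
apply: (mulIf (lt0r_neq0 A0)); rewrite mulfVK ?gt_eqF //.
have {}uA : u * A / m%:R = 1 by apply: uA; rewrite divr_gt0 ?mulr_gt0.
by rewrite -(mulfVK (lt0r_neq0 M0) (u * A)) uA mul1r.
Qed.

End Likelihood.

(** * Stability against boundedness, existence and uniqueness of maximizers *)

Section MaximumLikelihood.
Variables (R : realType) (m n : nat) (G : set 'M[R]_m) (Y : 'M[R]_(m, n)).
Hypotheses (m_gt0 : (0 < m)%N) (n_gt0 : (0 < n)%N).
Hypothesis G_subgroup : subgroup_GL G.
Hypothesis G_zariski_closed : zariski_closed_GL G.
Hypothesis G_self_adjoint : self_adjoint G.
Hypothesis G_scalar_closed : scalar_closed G.

Local Notation H := (SLplus G).
Local Notation act := (@sample_action R m n).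
Local Notation ell u h := (log_likelihood Y (u *: (h^T *m h))).

Let H1 := SLplus1 G_subgroup.
Let HM := SLplusM G_subgroup.
Let HV := SLplusV G_subgroup.
Let HT := SLplusT G_self_adjoint.
Let Hdet := @SLplus_det R m G.
Let Hclosed := SLplus_closed G_zariski_closed.
Let Hpexp := fun Q a t => @SLplus_pexp R m G G_subgroup G_zariski_closed Q a t.
Let modelE := modelP m_gt0 G_subgroup G_zariski_closed G_self_adjoint G_scalar_closed.

Let M0 : 0 < m%:R :> R. Proof. by rewrite ltr0n. Qed.
Let N0 : 0 < n%:R :> R. Proof. by rewrite ltr0n. Qed.

Lemma ell_gram u h : 0 < u -> H h ->
  ell u h = m%:R * ln u - u * (sqn (h *m Y) / n%:R).
Proof. by move=> u0 [_ h1]; rewrite log_likelihood_gram. Qed.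

Lemma in_model u h : 0 < u -> H h -> gaussian_group_model G (u *: (h^T *m h)).
Proof. by move=> u0 Hh; apply/modelE; exists u, h. Qed.

Lemma unstable_unbounded : unstable act H Y -> ~ likelihood_bounded G Y.
Proof.
move=> /closure_mxcvg[u uH u0] [B BP].
(* At scale [c] the logarithmic term is at least [|B| + 2], while a small enough orbit vector makes
   the trace term less than [1]; the total exceeds [B]. *)
pose c := expR (`|B| + 2).
have c0 : 0 < c by exact: expR_gt0.
have small : \forall k \near uoo, sqn (u k) < n%:R / c.
  by apply: (cvgr_lt _ (mxcvg_sqn u0)); rewrite sqn0 divr_gt0.
have [k] := filter_ex small; have [h Hh <-] := uH k => hc.
have : ell c h <= B by apply: BP; exists (c *: (h^T *m h)) => //; exact: in_model.
rewrite ell_gram // expRK leNgt => /negP; apply.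
have mB : `|B| + 2 <= m%:R * (`|B| + 2).
  by rewrite ler_peMl ?addr_ge0 // ler1n.
have : c * (sqn (h *m Y) / n%:R) < 1.
  rewrite mulrA ltr_pdivrMr // mul1r mulrC.
  by move: hc; rewrite ltr_pdivlMr.
have := ler_norm B; lra.
Qed.

Lemma semistable_bounded : semistable act H Y -> likelihood_bounded G Y.
Proof.
move=> nclosed.
(* Otherwise some orbit vectors have norms tending to zero, which puts [0] in the closure. *)
have [d d0 dH] : exists2 d, 0 < d & forall h, H h -> d <= sqn (h *m Y).
  apply: contrapT => nd; apply: nclosed.
  have /choice[h hP] (k : nat) : exists h, H h /\ sqn (h *m Y) < k.+1%:R^-1.
    apply: contrapT => /forallNP nh; apply: nd; exists k.+1%:R^-1; first by rewrite invr_gt0.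
    by move=> h Hh; rewrite leNgt; apply/negP => hk; apply: (nh h).
  have [L hL] : exists L, mxcvg (fun k => h k *m Y) L.
    apply: (@bounded_mxcvg _ _ _ _ 1); apply: nearW => k.
    by apply: le_trans (ltW (hP k).2) _; rewrite invf_le1 // ler1n.
  suff L0 : L = 0.
    apply: (@mxcvg_closure _ _ _ _ (fun k => h k *m Y)); last by rewrite -L0.
    by move=> k; exists (h k) => //; case: (hP k).
  apply: sqn_eq0; apply/eqP; rewrite eq_le sqn_ge0 andbT.
  apply: (ler_cvg_to (mxcvg_sqn hL) (@inv_nat_ucvg0 R)).
  by apply: nearW => k; exact: ltW (hP k).2.
exists (m%:R * (ln (m%:R / (d / n%:R)) - 1)) => _ [_ /modelE[u [h [u0 Hh ->]]] <-].
rewrite ell_gram //; apply: le_trans (scale_le m_gt0 u0 (divr_gt0 d0 N0)).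
by rewrite lerD2l lerN2 ler_wpM2l ?(ltW u0) // ler_wpM2r ?dH // invr_ge0 ltW.
Qed.

(** Varying [h] at fixed [u] shows that [h *m Y] is minimal, and varying [u] at fixed [h] determines
    [u]; conversely, the two optimizations together bound the likelihood on the model. *)
Lemma MLE_gramP u h : 0 < u -> H h ->
  MLEs G Y (u *: (h^T *m h)) <->
  [/\ 0 < sqn (h *m Y), forall h', H h' -> sqn (h *m Y) <= sqn (h' *m Y)
    & u = m%:R / (sqn (h *m Y) / n%:R)].
Proof.
move=> u0 Hh; split=> [[_ umax]|[hY hmin uE]].
  have hmin h' : H h' -> sqn (h *m Y) <= sqn (h' *m Y).
    move=> Hh'; have := umax _ (in_model u0 Hh').
    by rewrite !ell_gram // lerD2l lerN2 ler_pM2l // ler_pM2r // invr_gt0.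
  (* If [h *m Y] were zero, doubling [u] would increase the likelihood. *)
  have hY : 0 < sqn (h *m Y).
    rewrite lt0r sqn_ge0 andbT; apply/eqP => hY0.
    have u2 : 0 < 2 * u by rewrite mulr_gt0.
    have := umax _ (in_model u2 Hh).
    rewrite !ell_gram // hY0 mul0r !mulr0 !subr0 ler_pM2l // ler_ln ?posrE //.
    lra.
  have A0 : 0 < sqn (h *m Y) / n%:R by rewrite divr_gt0.
  split => //; apply: scale_max_unique => //.
  have v0 : 0 < m%:R / (sqn (h *m Y) / n%:R) by rewrite divr_gt0.
  by have := umax _ (in_model v0 Hh); rewrite !ell_gram // scale_max.
split; first exact: in_model.
have A0 : 0 < sqn (h *m Y) / n%:R by rewrite divr_gt0.
move=> _ /modelE[v [h' [v0 Hh' ->]]]; rewrite !ell_gram // [in leRHS]uE scale_max //.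
apply: le_trans (scale_le m_gt0 v0 A0).
by rewrite lerD2l lerN2 ler_wpM2l ?(ltW v0) // ler_wpM2r ?hmin // invr_ge0 ltW.
Qed.

Lemma polystable_MLE : polystable act H Y -> MLEs G Y !=set0.
Proof.
move=> [Y0 clY].
have [||_ [h Hh <-] hmin] := @sqn_argmin R m n (orbit_of act H Y).
- by exists (act 1%:M Y), 1%:M.
- by move=> u L uA uL; apply: clY; exact: mxcvg_closure uA uL.
have hY : 0 < sqn (h *m Y).
  apply: sqn_gt0; apply: contra_neq Y0 => hY0.
  by rewrite -[Y]mul1mx -(mulVmx (group_unit Hdet Hh)) -mulmxA hY0 mulmx0.
exists (m%:R / (sqn (h *m Y) / n%:R) *: (h^T *m h)).
apply/MLE_gramP => //; first by rewrite !divr_gt0.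
by split => // h' Hh'; apply: hmin; exists h'.
Qed.

Lemma MLE_polystable : MLEs G Y !=set0 -> polystable act H Y.
Proof.
move=> [Psi MLE]; have [/modelE[u [h [u0 Hh PsiE]]] _] := MLE.
move: MLE; rewrite PsiE => /(MLE_gramP u0 Hh)[hY hmin _].
split; first by apply: contraTneq hY => ->; rewrite mulmx0 sqn0 ltxx.
move=> Z /closure_mxcvg[z zP zZ].
have /choice[g gP] k : exists g, H g /\ g *m Y = z k.
  by have [g Hg <-] := zP k; exists g.
have hu := group_unit Hdet Hh.
have gh k : g k *m invmx h *m (h *m Y) = z k.
  by rewrite mulmxA mulmxKV //; case: (gP k).
(* The closedness criterion needs a minimal base point, so the orbit is rebased at [h *m Y]. *)
have [|||k Hk <-] := @minimal_closed _ _ _ H1 HM HT Hdet Hclosed Hpexp n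
    (h *m Y) Z (fun k => g k *m invmx h).
- by move=> h' Hh'; rewrite mulmxA; apply: hmin; exact: HM.
- by move=> k; apply: HM; [case: (gP k)|exact: HV].
- by under eq_fun do rewrite gh.
- by exists (k *m h); [exact: HM|rewrite /sample_action mulmxA].
Qed.

Lemma infinite_family (T : Type) (f : nat -> T) (A : set T) :
  injective f -> (forall k, A (f k)) -> ~ finite_set A.
Proof.
move=> f_inj fA /(@finite_preimage _ _ _ f) fin; apply: infinite_nat.
have <- : f @^-1` A = setT by apply/seteqP; split => // k _; exact: fA.
by apply: fin => x y _ _; exact: f_inj.
Qed.

Lemma pexp_scale_inj (Q : 'M[R]_m) (b : 'rV[R]_m) s t : Q^T *m Q = 1%:M -> b != 0 ->
  pexp Q (s *: b) = pexp Q (t *: b) -> s = t.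
Proof.
move=> QQ b0 E; have [i bi] : exists i, b 0 i != 0.
  apply: contrapT => /forallNP nb; move/eqP: b0; apply; apply/rowP => i.
  by rewrite mxE; apply/eqP/negPn/negP; exact: nb.
have conj a : Q^T *m pexp Q a *m Q = diag_mx (map_mx expR a).
  by rewrite /pexp !mulmxA QQ mul1mx -mulmxA QQ mulmx1.
have := congr1 (fun A => Q^T *m A *m Q) E.
rewrite /= !conj => /matrixP/(_ i i); rewrite !mxE eqxx !mulr1n => /expR_inj.
exact: mulIf.
Qed.

Lemma unitmx_inj (p q : 'M[R]_m) (A B : 'M[R]_m) : p \in unitmx -> q \in unitmx ->
  p *m A *m q = p *m B *m q -> A = B.
Proof.
move=> pu qu E; rewrite -[A](mulKmx pu) -[p *m A](mulmxK qu) E.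
by rewrite (mulmxK qu) (mulKmx pu).
Qed.

(** Both maximizers have the same scale [u], hence different Gram matrices, which yields a
    one-parameter group fixing [h *m Y]. Multiplying [h] by its elements gives infinitely many MLEs;
    conjugating them by [h] gives infinitely many stabilizers of [Y]. *)
Lemma distinct_MLEs Psi1 Psi2 : MLEs G Y Psi1 -> MLEs G Y Psi2 -> Psi1 <> Psi2 ->
  ~ finite_set (MLEs G Y) /\ ~ finite_set (stabilizer_of act H Y).
Proof.
move=> MLE1 MLE2.
have [/modelE[u [h [u0 Hh E1]]] _] := MLE1; have [/modelE[v [g [v0 Hg E2]]] _] := MLE2.
move: MLE1 MLE2; rewrite {}E1 {}E2 => MLE1 MLE2 neq.
have [hY hmin uE] := (MLE_gramP u0 Hh).1 MLE1.
have [gY gmin vE] := (MLE_gramP v0 Hg).1 MLE2.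
have gh : sqn (g *m Y) = sqn (h *m Y) by apply/eqP; rewrite eq_le gmin // hmin.
have uv : u = v by rewrite uE vE gh.
have neq' : g^T *m g <> h^T *m h by move=> gghh; apply: neq; rewrite uv gghh.
have [Q [b [QQ b0 Hb bY]]] := polar_pair HM HV HT Hdet Hpexp hmin Hh Hg gh neq'.
have hu := group_unit Hdet Hh.
have hTu : h^T \in unitmx by rewrite unitmx_tr.
split.
  pose f k := pexp Q ((k%:R : R) *: b) *m h.
  apply: (@infinite_family _ (fun k => u *: ((f k)^T *m f k))) => [k l|k].
    move=> /(scalerI (lt0r_neq0 u0)).
    have fE t : (pexp Q (t *: b) *m h)^T *m (pexp Q (t *: b) *m h) =
        h^T *m pexp Q ((t + t) *: b) *m h.
      rewrite (trmx_mul _ h) pexpT scalerDl pexpD //.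
      by move: (pexp Q _) => p; rewrite !mulmxA.
    rewrite /f !fE => /(unitmx_inj hTu hu).
    move=> /(pexp_scale_inj QQ b0)/eqP.
    by rewrite -!natrD eqr_nat !addnn => /eqP/double_inj.
  apply/MLE_gramP => //; first exact: HM.
  by rewrite /f -mulmxA bY.
apply: (@infinite_family _ (fun k => invmx h *m pexp Q ((k%:R : R) *: b) *m h)).
  have hVu : invmx h \in unitmx by rewrite unitmx_inv.
  move=> k l /(unitmx_inj hVu hu)/(pexp_scale_inj QQ b0)/eqP.
  by rewrite eqr_nat => /eqP.
move=> k; split; first by apply: HM => //; apply: HM => //; exact: HV.
by rewrite /sample_action -(mulmxA _ h Y) -(mulmxA (invmx h)) bY mulKmx.
Qed.

End MaximumLikelihood.

Theorem theorem3p10 (R : realType) (m n : nat) (m_gt0 : (0 < m)%N)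
    (n_gt0 : (0 < n)%N) (G : set 'M[R]_m) (Y : 'M[R]_(m, n))
    (G_subgroup : subgroup_GL G)
    (G_zariski_closed : zariski_closed_GL G)
    (G_self_adjoint : self_adjoint G)
    (G_scalar_closed : scalar_closed G) :
  [/\ unstable (@sample_action R m n) (SLplus G) Y <->
        ~ likelihood_bounded G Y,
      semistable (@sample_action R m n) (SLplus G) Y <->
        likelihood_bounded G Y,
      polystable (@sample_action R m n) (SLplus G) Y <->
        MLEs G Y !=set0
    & (stable (@sample_action R m n) (SLplus G) Y ->
         MLEs G Y !=set0 /\ finite_set (MLEs G Y)) /\
      (MLEs G Y !=set0 /\ finite_set (MLEs G Y) <->
         exists! Psi, MLEs G Y Psi)].
Proof.
have unst : unstable (@sample_action R m n) (SLplus G) Y -> ~ likelihood_bounded G Y.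
  exact: unstable_unbounded.
have semi : semistable (@sample_action R m n) (SLplus G) Y -> likelihood_bounded G Y.
  exact: semistable_bounded.
have distinct Psi1 Psi2 : MLEs G Y Psi1 -> MLEs G Y Psi2 -> Psi1 <> Psi2 ->
    ~ finite_set (MLEs G Y) /\
    ~ finite_set (stabilizer_of (@sample_action R m n) (SLplus G) Y).
  exact: distinct_MLEs.
have uniq_fin Psi : MLEs G Y Psi -> (forall Phi, MLEs G Y Phi -> Psi = Phi) ->
    finite_set (MLEs G Y).
  move=> PsiM PsiU; rewrite (_ : MLEs G Y = [set Psi]); first exact: finite_set1.
  by apply/seteqP; split => [Phi /PsiU ->|_ ->].
have poly : polystable (@sample_action R m n) (SLplus G) Y -> MLEs G Y !=set0.
  exact: polystable_MLE.
split.
- by split=> // nb; apply: contrapT => /semi.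
- by split=> // bd un; exact: unst bd.
- by split=> //; exact: MLE_polystable.
split=> [[pst fin]|].
  have [Psi PsiM] := poly pst; split; first by exists Psi.
  (* A second MLE would make the stabilizer infinite. *)
  apply: (uniq_fin Psi) => // Phi PhiM; apply: contrapT.
  by move=> /(distinct _ _ PsiM PhiM)[].
split=> [[[Psi PsiM] fin]|[Psi [PsiM PsiU]]].
  (* A second MLE would make the set of MLEs infinite. *)
  exists Psi; split=> // Phi PhiM; apply: contrapT.
  by move=> /(distinct _ _ PsiM PhiM)[].
by split; [exists Psi|exact: uniq_fin PsiM PsiU].
Qed.
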